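(* Let $U$ be a random variable uniformly distributed in $[0,1]$, let $f:(0,1)\to\mathbb{R}$ satisfy $f\in L^1_{loc}((0,1))$, and for $n=0,1,2,\dots$ let $V_n[f]:=f(U)\sin(nU)$. Then the sequence of random variables $V_n[f]$ converges in law, as $n\to\infty$, to a random variable $V$ such that $$\mathbb{E}(e^{itV})=\int_0^1 J_0(t f(u))\,du\qquad\text{for all } t\in\mathbb{R}.$$
   Context: $J_0$ is the Bessel function of the first kind of order $0$: $J_0(x)=\frac{1}{2\pi}\int_{-\pi}^{\pi}e^{ix\sin(u)}\,du$ for $x\in\mathbb{R}$. $L^1_{loc}((0,1))$ is the set of functions that are Lebesgue integrable on every compact subset of the open interval $(0,1)$. $\mathbb{E}$ denotes expectation, and convergence in law means convergence in distribution. *)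

(* Defs.v *)
From HB Require Import structures.
From mathcomp Require Import all_boot all_order all_algebra.
From mathcomp Require Import all_classical all_reals all_analysis.
From mathcomp Require Import complex.

Set Implicit Arguments.
Unset Strict Implicit.
Unset Printing Implicit Defensive.

Import Order.TTheory GRing.Theory Num.Theory.
Import numFieldNormedType.Exports.

Local Open Scope classical_set_scope.
Local Open Scope ring_scope.

(* exp(i x) for real x. *)
Definition expi (R : realType) (x : R) : R[i] := Complex (cos x) (sin x).

Definition cintegral (d : measure_display) (T : measurableType d)
    (R : realType) (mu : {measure set T -> \bar R}) (D : set T)
    (g : T -> R[i]) : R[i] :=
  Complex (\int[mu]_(x in D) complex.Re (g x))
          (\int[mu]_(x in D) complex.Im (g x)).

Definition J0 (R : realType) (x : R) : R[i] :=
  ((2 * pi)^-1)%:C%C *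
  cintegral (@lebesgue_measure R) `[- pi, pi] (fun u => expi (x * sin u)).

(* Measurability and integrals are taken with respect to the completed Lebesgue
   measure, whose domain is the sigma-algebra of all Lebesgue-measurable sets;
   [lebesgue_measure] and [locally_integrable] only cover Borel functions. *)
Definition L1loc (R : realType) (D : set R) (f : R -> R) : Prop :=
  forall K : set R, compact K -> K `<=` D ->
    (@completed_lebesgue_measure R).-integrable K (EFin \o f).

Definition uniform01 (d : measure_display) (T : measurableType d)
    (R : realType) (P : probability T R) (U : {RV P >-> R}) : Prop :=
  forall A : set R, measurable A ->
    distribution P U A = uniform_prob (@ltr01 R) A.

Definition charfun (d : measure_display) (T : measurableType d)
    (R : realType) (P : probability T R) (X : {RV P >-> R}) (t : R) : R[i] :=
  cintegral P setT (fun w => expi (t * X w)).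

Definition cvg_in_law (d d' : measure_display) (T : measurableType d)
    (T' : measurableType d') (R : realType) (P : probability T R)
    (P' : probability T' R) (X : nat -> {RV P >-> R}) (Y : {RV P' >-> R})
    : Prop :=
  forall x : R, {for x, continuous (cdf Y)} ->
    cdf (X n) x @[n --> \oo] --> cdf Y x.

(* Main.v *)
(** Let g be a Borel function equal to f almost everywhere on (0,1). The limit is
    the variable g(u) sin(s), with (u, s) uniform on [0,1] x [-pi,pi]; its
    characteristic function is the stated integral of J0 by Fubini's theorem.

    For the convergence, translating u by s/n turns g(u) sin(nu) into
    g(u + s/n) sin(nu + s). By Lusin's theorem and uniform continuity on compact
    sets, g(u + s/n) is close to g(u) outside a set of small measure, uniformly
    in s in [-pi,pi]. Hence, if B contains a neighbourhood of A of fixed radius,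
    |{u : g(u) sin(nu) in A}| <= |{u : g(u) sin(nu + s) in B}| + eta for large n.
    Averaging over s and using that sin(nu + s) and sin(s) have the same law for
    uniform s, the right-hand side becomes P(g(u) sin(s) in B) + eta. Taking
    half-lines for A and B gives the convergence of the distribution functions. *)
Require Import Defs.
From HB Require Import structures.
From mathcomp Require Import all_boot all_order all_algebra.
From mathcomp Require Import all_classical all_reals all_analysis.
From mathcomp Require Import measurable_realfun complex.
From mathcomp Require Import ring lra.

Set Implicit Arguments.
Unset Strict Implicit.
Unset Printing Implicit Defensive.

Import Order.TTheory GRing.Theory Num.Theory.
Import numFieldNormedType.Exports.

Local Open Scope classical_set_scope.
Local Open Scope ring_scope.

Notation hlength R := (@wlength R idfun).

(** * Borel representatives of Lebesgue-measurable sets and functions *)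

Lemma caratheodory_sub_borel (R : realType) (A : set R) :
  (hlength R)^*%mu.-cara.-measurable A ->
  exists B M : set R, [/\ measurable B, measurable M,
    lebesgue_measure M = 0%E & forall x, ~ M x -> A x <-> B x].
Proof.
rewrite -(@completed_caratheodory_measurable R) g_sigma_completed_algebra_genE.
move=> [B mB [N [M [mM M0 NM]]] <-]; exists B, M; split => //= x Mx.
by split => [[//|/NM]//|]; left.
Qed.

Lemma sub_completed (R : realType) (A : set R) :
  measurable A -> (hlength R)^*%mu.-cara.-measurable A.
Proof. exact: sub_caratheodory. Qed.

Lemma measure_bigcup_eq0 d (T : measurableType d) (R : realType)
    (mu : {measure set T -> \bar R}) (F : (set T)^nat) :
  (forall n, measurable (F n)) -> (forall n, mu (F n) = 0%E) ->
  mu (\bigcup_n F n) = 0%E.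
Proof.
move=> mF F0; apply: measure_negligible; first exact: bigcupT_measurable.
by apply: negligible_bigcup => n; exists (F n); split.
Qed.

(** Each rational sublevel set is Borel up to a null set, and the union [N] of these countably many
    null sets is null. Replaced by 0 outside [D] minus [N], [f] becomes Borel, because {f < r} is
    the union of {f < q} over the rationals q < r. *)
Lemma borel_representative (R : realType) (D : set R) (f : R -> R) :
  measurable D ->
  (forall q : R, (hlength R)^*%mu.-cara.-measurable (D `&` [set x | f x < q])) ->
  exists g N, [/\ measurable_fun setT g, measurable N,
    lebesgue_measure N = 0%E & forall x, D x -> ~ N x -> g x = f x].
Proof.
move=> mD mf.
have /choice[B /choice[M BM]] := fun q : R => caratheodory_sub_borel (mf q).
pose M' n := if unpickle n is Some q then M (ratr (q : rat)) else set0.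
have mM' n : measurable (M' n).
  by rewrite /M'; case: unpickle => // q; have [] := BM (ratr q).
have M'0 n : lebesgue_measure (M' n) = 0%E.
  rewrite /M'; case: unpickle => [q|]; last by rewrite measure0.
  by have [] := BM (ratr q).
pose N := \bigcup_n M' n.
have mN : measurable N by exact: bigcupT_measurable.
have MN q : M (ratr q) `<=` N.
  by move=> x Mx; exists (pickle q); rewrite ?/M' ?pickleK.
have N0 : lebesgue_measure N = 0%E.
  exact: (@measure_bigcup_eq0 _ (measurableTypeR R) R (@lebesgue_measure R) M').
exists (fun x => if x \in D `\` N then f x else 0), N; split => //; last first.
  by move=> x Dx Nx; rewrite mem_set.
apply: (measurability _ (RGenInftyO.measurableE R)) => //.
move=> _ [_ [r ->] <-]; rewrite setTI.
(* The last piece accounts for the default value 0, which lies below [r] exactly when [0 < r]. *)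
rewrite (_ : _ @^-1` _ =
  \bigcup_(q in [set: rat])
    (if ratr q < r then B (ratr q) `&` (D `\` N) else set0) `|`
  (if 0 < r then ~` (D `\` N) else set0)).
  apply: measurableU; last first.
    by case: ifPn => // _; apply: measurableC; exact: measurableD.
  apply: bigcupT_measurable_rat => q; case: ifPn => // _.
  by apply: measurableI; [have [] := BM (ratr q)|exact: measurableD].
apply/seteqP; split => x /=; rewrite in_itv/=.
  case: ifPn => [/set_mem DNx fr|/negP DNx r0].
    have [q] := rat_in_itvoo fr; rewrite in_itv/= => /andP[fq qr].
    left; exists q => //; rewrite qr; split => //.
    have [_ _ _ /(_ x) Bx] := BM (ratr q); apply: (Bx _).1.
      by move/MN; case: DNx.
    by case: DNx.
  by right; rewrite r0 => /mem_set.
case=> [[q _]|].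
  case: ifPn => // qr [Bx DNx]; rewrite mem_set//.
  apply: lt_trans qr; have [_ _ _ /(_ x)] := BM (ratr q).
  case=> [/MN|_ /(_ Bx)]; first by case: DNx.
  by case.
case: ifPn => // r0 DNx; case: ifPn => [/set_mem//|//].
Qed.

(** * Translation, uniform continuity and periodicity on the real line *)

(** The pushforward under translation gives half-open intervals their length, and this determines
    Lebesgue measure. *)
Lemma lebesgue_measure_translate (R : realType) (c : R) (A : set R) :
  measurable A -> lebesgue_measure [set x | A (x + c)] = lebesgue_measure A.
Proof.
move=> mA.
pose tr : measurableTypeR R -> measurableTypeR R := fun x => x + c.
have mtr : measurable_fun setT tr.
  by apply: measurable_funD.
pose trm : {mfun measurableTypeR R >-> measurableTypeR R} :=
  mfun_Sub (mem_set mtr).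
rewrite -[LHS]/(pushforward lebesgue_measure trm A).
apply/esym/lebesgue_measure_unique => //= _ [[a b]] _ <-.
rewrite /pushforward (_ : _ @^-1` _ = `]a - c, b - c]%classic).
  rewrite !lebesgue_measure_itv/= !lte_fin ltrD2r; case: ifPn => //.
  by rewrite -!EFinB => _; congr (_%:E); ring.
by apply/seteqP; split => x /=; rewrite !in_itv/= /tr ltrBlDr lerBrDr.
Qed.

(** Heine-Cantor relative to [K]: the estimate holds for small [d] near each point of [K], and
    compactness makes one [d] serve everywhere. *)
Lemma compact_uniformly_continuous (R : realType) (K : set R) (g : R -> R)
    (e : R) :
  compact K -> {within K, continuous g} -> 0 < e ->
  exists2 d, 0 < d &
    forall x y, K x -> K y -> `|x - y| < d -> `|g x - g y| < e.
Proof.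
move=> /compact_near_coveringP/near_covering_withinP cK.
move=> /subspace_continuousP cg e0.
have : \forall d \near 0^'+,
    K `<=` (fun x => forall y, K y -> `|x - y| < d -> `|g x - g y| < e).
  apply: cK => x Kx; have /cvgrPdist_lt/(_ (e / 2)) := cg _ Kx.
  rewrite divr_gt0// => /(_ isT) /nbhs_ballP[r /= r0 xr].
  have r20 : 0 < r / 2 by rewrite divr_gt0.
  (* With half the radius, a point within [d] of [x'] still lies in the ball of radius [r] about
     [x]. *)
  exists (ball x (r / 2), [set d | d < r / 2]).
    by split => /=; [exact: nbhsx_ballx|exact: nbhs_right_lt].
  move=> [x' d] /= [xx' dr] Kx' y Ky x'y.
  have x'r : ball x r x' by apply: le_ball xx'; lra.
  have yr : ball x r y.
    rewrite [r]splitr; apply: ball_triangle xx' _.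
    exact: lt_trans x'y dr.
  have /= gx' := xr x' x'r Kx'.
  have /= gy := xr y yr Ky.
  rewrite [e]splitr (_ : _ - _ = (g x - g y) - (g x - g x')); last by ring.
  by rewrite (le_lt_trans (ler_normB _ _))// ltrD.
move=> H; near (0:R)^'+ => d; exists d => //.
by move=> x y Kx; apply: (near H d) => //.
Unshelve. all: by end_near. Qed.

(** A window starting in [[0, p]] splits at [p], and its right part is the translate by [p] of the
    initial piece missing on the left. Other windows reduce to this case by removing floor(a / p)
    periods. *)
Lemma periodic_measure (R : realType) (E : set R) (p : R) :
  0 < p -> measurable E -> (forall x, E (x + p) <-> E x) ->
  forall a, lebesgue_measure (E `&` `[a, a + p[) =
            lebesgue_measure (E `&` `[0, p[).
Proof.
move=> p0 mE Ep.
have shift a b : lebesgue_measure (E `&` `[a + p, b + p[) =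
                 lebesgue_measure (E `&` `[a, b[).
  rewrite -(@lebesgue_measure_translate _ p); last exact: measurableI.
  congr lebesgue_measure; apply/seteqP; split => x /=;
    by rewrite !in_itv/= lerD2r ltrD2r => -[/Ep Ex ?].
have split_at a b c : a <= b -> b <= c ->
    lebesgue_measure (E `&` `[a, c[) = (lebesgue_measure (E `&` `[a, b[) +
      lebesgue_measure (E `&` `[b, c[))%E.
  move=> ab bc; rewrite -measureU//=; [|exact: measurableI..|]; last first.
    apply/seteqP; split => x //= [[_]]; rewrite !in_itv/= => /andP[_ xb] [_].
    by rewrite leNgt xb.
  rewrite -setIUr; congr (lebesgue_measure (_ `&` _)).
  by rewrite -itv_bndbnd_setU.
have base a : 0 <= a <= p -> lebesgue_measure (E `&` `[a, a + p[) =
            lebesgue_measure (E `&` `[0, p[).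
  move=> /andP[a0 ap]; rewrite (split_at a p)// ?lerDr//.
  by rewrite -{2}[p]add0r shift addeC -split_at.
have nshift a n : lebesgue_measure (E `&` `[a + p *+ n, a + p *+ n + p[) =
    lebesgue_measure (E `&` `[a, a + p[).
  elim: n => [|n <-]; first by rewrite addr0.
  by rewrite mulrSr addrA shift.
move=> a; set k := Num.floor (a / p).
have [ka ak] : k%:~R * p <= a /\ a <= (k%:~R + 1) * p.
  have /andP[] := floor_itv (a / p); rewrite intrD.
  by rewrite ler_pdivlMr// ltr_pdivrMr// => ? /ltW.
have -> : a = (a - k%:~R * p) + k%:~R * p by ring.
rewrite -(base (a - k%:~R * p)); last by apply/andP; split; lra.
move: (a - k%:~R * p) (k) => b {ka ak k} [] n.
  by rewrite -pmulrn mulr_natl nshift.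
(* [Negz n] is -(n + 1), so here the window is moved up by n + 1 periods. *)
by rewrite NegzE mulrNz mulNr -pmulrn mulr_natl -[LHS](nshift _ n.+1) subrK.
Qed.

(** * Uniform laws and the sine of a shifted uniform angle *)

Lemma uniform_probE (R : realType) (a b : R) (ab : a < b) (A : set R) :
  measurable A ->
  uniform_prob ab A = ((b - a)^-1%:E * lebesgue_measure (A `&` `[a, b]))%E.
Proof.
move=> mA; have -> : uniform_prob ab A = (\int[uniform_prob ab]_x (\1_A x)%:E)%E.
  by rewrite integral_indic// setIT.
rewrite integral_uniform//=; first by rewrite integral_indic.
exact/measurable_EFinP/measurable_indic.
Qed.

Lemma Npi_lt_pi (R : realType) : - pi < pi :> R.
Proof. by have := pi_gt0 R; lra. Qed.

Lemma measurable_sin (R : realType) : measurable_fun setT (@sin R).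
Proof. by apply: continuous_measurable_fun; exact: continuous_sin. Qed.

Lemma measurable_cos (R : realType) : measurable_fun setT (@cos R).
Proof. by apply: continuous_measurable_fun; exact: continuous_cos. Qed.

(** The shift moves the window [[- pi, pi[] to [[a - pi, a + pi[], and the preimage of [C] under
    sine has period 2 pi, so it has the same measure in both. *)
Lemma uniform_prob_sin_shift (R : realType) (a : R) (C : set R) :
  measurable C ->
  uniform_prob (Npi_lt_pi R) [set s | C (sin (a + s))] =
  uniform_prob (Npi_lt_pi R) [set s | C (sin s)].
Proof.
move=> mC.
have mE : measurable [set s : R | C (sin s)].
  by rewrite -[X in measurable X]setTI; exact: measurable_sin.
have mEa : measurable [set s : R | C (sin (a + s))].
  rewrite -[X in measurable X]setTI.
  apply: (measurableT_comp (@measurable_sin R)) => //.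
  exact: measurable_funD.
rewrite !uniform_probE//; congr *%E.
(* Dropping the null endpoint [pi] gives the half-open window that [periodic_measure] needs. *)
have Ico A : measurable A -> lebesgue_measure (A `&` `[- pi, pi : R]) =
    lebesgue_measure (A `&` `[- pi, pi[).
  move=> mA; rewrite -(@setUitv1 _ _ _ _ true); last first.
    by rewrite bnd_simp ltW// Npi_lt_pi.
  rewrite setIUr measureU0//; first exact: measurableI.
    exact: measurableI.
  apply/eqP; rewrite -measure_le0 -(lebesgue_measure_set1 (pi : R)).
  by apply: le_measure; rewrite ?inE//; exact: measurableI.
rewrite !Ico//.
have sinp x : C (sin (x + pi *+ 2)) <-> C (sin x) by rewrite sinD2pi.
have pi2 : 0 < pi *+ 2 :> R by rewrite pmulrn_lgt0// pi_gt0.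
transitivity (lebesgue_measure
    ([set s | C (sin s)] `&` `[a - pi, a - pi + pi *+ 2[)).
  rewrite -[RHS](@lebesgue_measure_translate _ a); last exact: measurableI.
  congr lebesgue_measure; apply/seteqP; split => x /=;
    rewrite !in_itv/= mulr2n [x + a]addrC => -[Cx /andP[xl xu]];
    by split => //; apply/andP; split; lra.
rewrite periodic_measure// -(@periodic_measure _ _ _ pi2 mE sinp (- pi)).
by rewrite mulr2n addrA addNr add0r.
Qed.

(** * Small translations of a Borel function on the unit interval *)

Lemma uniform_prob01E (R : realType) (A : set R) : measurable A ->
  uniform_prob (@ltr01 R) A = lebesgue_measure (A `&` `[0, 1]).
Proof. by move=> mA; rewrite uniform_probE// subr0 invr1 mul1e. Qed.

(** The radius [d] is chosen before [phi], so one [d] serves for all the functions sin(n u). The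
    loss [eta] is made of four quarters: the complement of the Lusin set [K], counted once for the
    point and once for its translate, and a strip at each end of the interval. *)
Lemma uniform_prob01_translate_le (R : realType) (g : R -> R) (e eta : R) :
  measurable_fun setT g -> 0 < e -> 0 < eta ->
  exists2 d, 0 < d &
    forall (phi : R -> R) (h : R) (A B : set R),
      measurable_fun setT phi -> (forall x, `|phi x| <= 1) ->
      measurable A -> measurable B ->
      (forall a b, A a -> `|a - b| < e -> B b) -> `|h| < d ->
      (uniform_prob (@ltr01 R) [set u | A (g u * phi u)%R] <=
       uniform_prob (@ltr01 R) [set u | B (g u * phi (u + h))%R] + eta%:E)%E.
Proof.
move=> mg e0 eta0; have eta40 : 0 < eta / 4 by rewrite divr_gt0.
have [||||K [cK KI IK cg]] :=
  @measurable_almost_continuous R `[0, 1] _ _ g (eta / 4).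
- exact: measurable_itv.
- by rewrite /= lebesgue_measure_itv/= lte_fin ltr01 -EFinB ltry.
- exact: eta40.
- exact: measurable_funTS.
have [d d0 gd] := compact_uniformly_continuous cK cg e0.
exists (Num.min d (eta / 4)); first by rewrite lt_min d0.
move=> phi h A B mphi phi1 mA mB AB; rewrite lt_min => /andP[hd heta].
have mK : measurable K by exact: compact_measurable.
have mS : measurable [set u | A (g u * phi u)].
  by rewrite -[X in measurable X]setTI; apply: (measurable_funM mg mphi).
have mphih : measurable_fun setT (fun u : R => phi (u + h)).
  by apply: measurableT_comp => //; exact: measurable_funD.
have mT : measurable [set u | B (g u * phi (u + h))].
  by rewrite -[X in measurable X]setTI; apply: (measurable_funM mg mphih).
rewrite !uniform_prob01E//.
pose S := [set u | A (g u * phi u)]; pose T := [set u | B (g u * phi (u + h))].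
pose I01 : set R := `[0, 1]%classic; rewrite -/S -/T -/I01.
pose mu := @lebesgue_measure R; rewrite -/mu.
have mI : measurable I01 by exact: measurable_itv.
have h0 : 0 <= `|h| by [].
(* If [x + h] is in [[0, 1]] but [x] is not in the open interval, then [x] lies in one of these
   strips. *)
pose Il : set R := `[- `|h|, 0]%classic.
pose Ir : set R := `[1, 1 + `|h|]%classic.
have mIl : measurable Il by exact: measurable_itv.
have mIr : measurable Ir by exact: measurable_itv.
have muE1 : (mu Il <= (eta / 4)%:E)%E.
  rewrite /mu lebesgue_measure_itv/=.
  by case: ifPn => _; rewrite -?EFinB lee_fin ?opprK ?add0r ltW.
have muE2 : (mu Ir <= (eta / 4)%:E)%E.
  rewrite /mu lebesgue_measure_itv/=.
  by case: ifPn => _; rewrite -?EFinB lee_fin 1?addrC ?addKr ltW.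
have SK : (mu (S `&` I01) <= mu (I01 `\` K) + mu (S `&` K))%E.
  apply: (@le_trans _ _ (mu ((I01 `\` K) `|` (S `&` K)))).
    apply: le_measure; rewrite ?inE; [exact: measurableI| |].
      by apply: measurableU; [exact: measurableD|exact: measurableI].
    by move=> x [Sx Ix]; have [Kx|Kx] := pselect (K x); [right|left].
  by apply: measureU2; [exact: measurableD|exact: measurableI].
have KT : (mu (S `&` K) <= mu (T `&` I01) + (mu (I01 `\` K) +
    (mu Il + mu Ir)))%E.
  rewrite -[leLHS](@lebesgue_measure_translate _ h); last exact: measurableI.
  have mSK : measurable [set x | (S `&` K) (x + h)].
    rewrite -[X in measurable X]setTI.
    have : measurable_fun setT (fun x : R => x + h) by exact: measurable_funD.
    by apply => //; exact: measurableI.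
  apply: (@le_trans _ _ (mu ((T `&` I01) `|` ((I01 `\` K) `|`
      (Il `|` Ir))))).
    apply: le_measure; rewrite ?inE//.
      apply: measurableU; first exact: measurableI.
      by apply: measurableU; [exact: measurableD|exact: measurableU].
    move=> x [Sx Kx]; have := KI _ Kx; rewrite /= in_itv/=.
    have [hl hr] := (ler_norm h, ler_norm (- h)); rewrite normrN in hr.
    move=> /andP[xh0 xh1].
    have [x0|x0] := leP x 0.
      by right; right; left; rewrite /Il /= in_itv/=; apply/andP; split; lra.
    have [x1|x1] := leP 1 x.
      by right; right; right; rewrite /Ir /= in_itv/=; apply/andP; split; lra.
    have Ix : I01 x by rewrite /I01 /= in_itv/= !ltW.
    have [Kx'|Kx'] := pselect (K x); last by right; left.
    (* The two products share the factor [phi (x + h)], bounded by 1, so they differ by at most |g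
       (x + h) - g x| < e. *)
    left; split => //; apply: AB Sx _.
    rewrite -mulrBl normrM (le_lt_trans (ler_piMr _ (phi1 _)))//.
    by apply: gd => //; rewrite addrC addKr.
  apply: le_trans (measureU2 _ _ _) _ => //; first exact: measurableI.
    by apply: measurableU; [exact: measurableD|exact: measurableU].
  apply: leeD => //; apply: le_trans (measureU2 _ _ _) _ => //.
  - exact: measurableD.
  - exact: measurableU.
  - by apply: leeD => //; exact: measureU2.
have etaE : (eta%:E =
    (eta / 4)%:E + ((eta / 4)%:E + ((eta / 4)%:E + (eta / 4)%:E)))%E.
  by rewrite -!EFinD; congr EFin; field.
rewrite etaE; apply: le_trans SK _.
rewrite addeCA; apply: leeD; first exact: ltW.
by apply: le_trans KT _; apply: leeD => //; apply: leeD; [exact: ltW|exact: leeD].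
Qed.

(** * Averaging the oscillation over a uniform angle *)

Definition unif01 (R : realType) : probability (measurableTypeR R) R :=
  uniform_prob (@ltr01 R).

Definition unif_angle (R : realType) : probability (measurableTypeR R) R :=
  uniform_prob (Npi_lt_pi R).

Section oscillation.
Context (R : realType).
Local Notation mR := (measurableTypeR R).
Local Notation mu1 := (unif01 R).
Local Notation mu2 := (unif_angle R).

(** Both iterated integrals give the same value on rectangles, so by uniqueness of the product
    measure the outer integral may run over the angle. *)
Lemma prod_prob_ysectionE (W : set (mR * mR)) : measurable W ->
  (mu1 \x mu2)%E W = (\int[mu2]_s mu1 (ysection W s))%E.
Proof.
move=> mW; rewrite -[RHS]/((mu1 \x^ mu2)%E W).
by apply: product_measure_unique => //= *; rewrite product_measure2E.
Qed.

Lemma measurable_mul_sin (g : R -> R) (B : set R) (a : R) :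
  measurable_fun setT g -> measurable B ->
  measurable [set z : mR * mR | B (g z.1 * sin (a * z.1 + z.2))].
Proof.
move=> mg mB; rewrite -[X in measurable X]setTI.
have mF : measurable_fun setT (fun z : mR * mR => g z.1 * sin (a * z.1 + z.2)).
  apply: measurable_funM; first exact: measurableT_comp.
  apply: (measurableT_comp (@measurable_sin R)).
  by apply: measurable_funD => //; exact: measurable_funM.
exact: mF.
Qed.

(** For fixed [u] the phase [a * u] only shifts a uniform angle, so the sections at [u] have equal
    probability. *)
Lemma prod_prob_sin_shift (g : R -> R) (B : set R) (a : R) :
  measurable_fun setT g -> measurable B ->
  (mu1 \x mu2)%E [set z : mR * mR | B (g z.1 * sin (a * z.1 + z.2))] =
  (mu1 \x mu2)%E [set z : mR * mR | B (g z.1 * sin z.2)].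
Proof.
move=> mg mB; rewrite /product_measure1; apply: eq_integral => u _ /=.
have mBu : measurable [set y : R | B (g u * y)].
  have mgu : measurable_fun setT (fun y : R => g u * y) by exact: measurable_funM.
  by rewrite -[X in measurable X]setTI; exact: mgu.
have := uniform_prob_sin_shift (a * u) mBu.
congr (_ = _); congr (uniform_prob _ _);
  by apply/seteqP; split => s /=; rewrite /xsection /= inE.
Qed.

(** Once pi / n < d, every angle [s] in [[- pi, pi]] gives an admissible translation s / n. The
    left-hand side does not involve [s], so it is bounded by the average over [s]. *)
Lemma sin_oscillation_le (g : R -> R) (e eta : R) :
  measurable_fun setT g -> 0 < e -> 0 < eta ->
  \forall n \near \oo, forall A B : set R, measurable A -> measurable B ->
    (forall a b, A a -> `|a - b| < e -> B b) ->
    (mu1 [set u | A (g u * sin (n%:R * u))%R] <=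
     (mu1 \x mu2) [set z : mR * mR | B (g z.1 * sin z.2)%R] + eta%:E)%E.
Proof.
move=> mg e0 eta0.
have [d d0 H] := uniform_prob01_translate_le mg e0 eta0.
near=> n => A B mA mB AB.
have n0 : 0 < n%:R :> R by rewrite ltr0n; near: n; exact: nbhs_infty_gt.
have pind : pi / n%:R < d.
  rewrite ltr_pdivrMr// mulrC -ltr_pdivrMr//; near: n; exact: nbhs_infty_gtr.
set W0 := [set z : mR * mR | B (g z.1 * sin z.2)].
pose W := [set z : mR * mR | B (g z.1 * sin (n%:R * z.1 + z.2))].
have mW : measurable W by exact: (measurable_mul_sin n%:R mg mB).
have -> : (mu1 \x mu2)%E W0 = (mu1 \x mu2)%E W.
  by rewrite (prod_prob_sin_shift n%:R mg mB).
rewrite prod_prob_ysectionE//.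
set c := mu1 _; pose G s := mu1 (ysection W s).
have mG : measurable_fun setT G by apply: measurable_fun_ysection.
pose J : set R := `[- pi, pi]%classic.
have mJ : measurable J by exact: measurable_itv.
have J1 : mu2 J = 1%E.
  exact: (integral_uniform_pdf1 (Npi_lt_pi R) (@subset_refl _ J)).
have cG s : J s -> (c <= G s + eta%:E)%E.
  rewrite /J /= in_itv/= => /andP[spi1 spi2].
  have mphi : measurable_fun setT (fun u : R => sin (n%:R * u)).
    by apply: (measurableT_comp (@measurable_sin R)); exact: measurable_funM.
  have := H (fun u => sin (n%:R * u)) (s / n%:R) A B mphi _ mA mB AB.
  have -> : [set u | B (g u * sin (n%:R * (u + s / n%:R)))] = ysection W s.
    apply/seteqP; split => u /=; rewrite /ysection/= inE /W /=;
      by rewrite mulrDr mulrCA divff ?gt_eqF// mulr1.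
  apply.
    by move=> x; rewrite ler_norml sin_geN1 sin_le1.
  rewrite normrM normfV (gtr0_norm n0) (le_lt_trans _ pind)//.
  by rewrite ler_pM2r ?invr_gt0// ler_norml spi1.
have -> : c = (\int[mu2]_(s in J) c)%E.
  by rewrite integral_cst// [X in (_ * X)%E]J1 mule1.
apply: (@le_trans _ _ (\int[mu2]_(s in J) (G s + eta%:E))%E).
  apply: ge0_le_integral => //.
  - by move=> s _; exact: measure_ge0.
  - by apply: emeasurable_funD => //; exact: measurable_funTS.
rewrite ge0_integralD//=.
- rewrite integral_cst// [X in (_ * X)%E]J1 mule1 leeD2r//.
  by apply: ge0_subset_integral.
- exact: measurable_funTS.
- by move=> s _; rewrite lee_fin ltW.
Unshelve. all: by end_near. Qed.
End oscillation.

(** * A criterion for convergence in law *)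

Lemma cvg_in_law_thickening (d d' : measure_display) (T : measurableType d)
    (T' : measurableType d') (R : realType) (P : probability T R)
    (P' : probability T' R) (X : nat -> {RV P >-> R}) (Y : {RV P' >-> R}) :
  (forall e eta : R, 0 < e -> 0 < eta ->
    \forall n \near \oo, forall A B : set R, measurable A -> measurable B ->
      (forall a b, A a -> `|a - b| < e -> B b) ->
      (distribution P (X n) A <= distribution P' Y B + eta%:E)%E) ->
  cvg_in_law X Y.
Proof.
move=> H x cx.
have finX n y : cdf (X n) y \is a fin_num by exact: fin_num_measure.
have finY y : cdf Y y \is a fin_num by exact: fin_num_measure.
rewrite -[cdf Y x]fineK//; apply/fine_cvgP; split; first exact: nearW.
apply/cvgrPdist_le => eps eps0.
have eta0 : 0 < eps / 2 by rewrite divr_gt0.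
have : fine (cdf Y y) @[y --> x] --> fine (cdf Y x).
  by apply: fine_cvg; rewrite fineK//; exact: cx.
move=> /cvgrPdist_lt/(_ _ eta0)/nbhs_ballP[r /= r0 xr].
have r20 : 0 < r / 2 by rewrite divr_gt0.
have ballP y : `|x - y| < r -> `|fine (cdf Y x) - fine (cdf Y y)| < eps / 2.
  by move=> xy; apply: xr.
have up : `|fine (cdf Y x) - fine (cdf Y (x + r / 2))| < eps / 2.
  by apply: ballP; rewrite opprD addNKr normrN gtr0_norm//; lra.
have dn : `|fine (cdf Y x) - fine (cdf Y (x - r / 2))| < eps / 2.
  by apply: ballP; rewrite opprD opprK addNKr gtr0_norm//; lra.
near=> n.
have Hn : forall A B : set R, measurable A -> measurable B ->
    (forall a b, A a -> `|a - b| < r / 2 -> B b) ->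
    (distribution P (X n) A <= distribution P' Y B + (eps / 2)%:E)%E.
  by near: n; exact: H.
have mray y : measurable (`]-oo, y]%classic : set R) by exact: measurable_itv.
have le_up : (cdf (X n) x <= cdf Y (x + r / 2) + (eps / 2)%:E)%E.
  apply: Hn => // a b /=; rewrite !in_itv/= ltr_norml => ax /andP[ab1 ab2]; lra.
have le_dn : (cdf Y (x - r / 2) <= cdf (X n) x + (eps / 2)%:E)%E.
  have cdfC (S : measurableType _) (Q : probability S R) (Z : {RV Q >-> R}) y :
      distribution Q Z (~` `]-oo, y]) = (1 - fine (cdf Z y))%:E.
    by rewrite probability_setC// EFinB fineK// fin_num_measure.
  have := Hn _ _ (measurableC (mray x)) (measurableC (mray (x - r / 2))).
  rewrite !cdfC -EFinD lee_fin => /(_ _)/wrap[].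
    move=> a b /=; rewrite !in_itv/= ltr_norml => /negP + /andP[ab1 ab2].
    by rewrite -ltNge => ax; apply/negP; rewrite -ltNge; lra.
  rewrite -(fineK (finX n x)) -(fineK (finY (x - r / 2))) -EFinD lee_fin; lra.
move: le_up le_dn up dn.
rewrite -(fineK (finX n x)).
rewrite -(fineK (finY (x - r / 2))) -(fineK (finY (x + r / 2))).
rewrite -!EFinD !lee_fin !ltr_norml /= => ? ? /andP[? ?] /andP[? ?].
by rewrite ler_norml; apply/andP; split; lra.
Unshelve. all: by end_near. Qed.

(** * Integrals against the uniform laws and the completed measure *)

Lemma integral_unif01 (R : realType) (f : R -> \bar R) :
  measurable_fun setT f ->
  (\int[unif01 R]_u f u = \int[@lebesgue_measure R]_(u in `]0%R, 1%R[) f u)%E.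
Proof.
move=> mf; rewrite -(@integral_itv_bndoo _ _ _ _ true false); last first.
  exact: measurable_funTS.
rewrite integralE [RHS]integralE.
rewrite !integral_uniform//;
  [|exact: measurable_funeneg|exact: measurable_funepos].
by rewrite subr0 invr1 !mul1e.
Qed.

(** Pushed forward along the identity to the Borel sigma-algebra, the completed measure is Lebesgue
    measure. *)
Lemma completed_integralE (R : realType) (D : set R) (f : R -> \bar R) :
  measurable D -> measurable_fun setT f ->
  (\int[@completed_lebesgue_measure R]_(x in D) f x =
   \int[@lebesgue_measure R]_(x in D) f x)%E.
Proof.
move=> mD mf.
pose I := caratheodory_type (hlength R)^*%mu.
pose j : I -> measurableTypeR R := idfun.
have mj : measurable_fun setT j.
  by move=> _ A mA; rewrite setTI; exact: sub_completed.
have ge0E (h : R -> \bar R) : measurable_fun setT h -> (forall x, 0 <= h x)%E ->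
  (\int[@completed_lebesgue_measure R]_(x in D) h x =
   \int[@lebesgue_measure R]_(x in D) h x)%E.
  move=> mh h0.
  transitivity
      (\int[pushforward (@completed_lebesgue_measure R) j]_(x in D) h x)%E.
    rewrite ge0_integral_pushforward//; first exact: measurable_funTS.
  exact: eq_measure_integral.
rewrite integralE [RHS]integralE.
by rewrite !ge0E//; [exact: measurable_funeneg|exact: measurable_funepos].
Qed.

Lemma bounded_integrable_prob d (T : measurableType d) (R : realType)
    (P : probability T R) (f : T -> R) :
  measurable_fun setT f -> (forall x, `|f x| <= 1) ->
  P.-integrable setT (EFin \o f).
Proof.
move=> mf f1; apply: measurable_bounded_integrable => //.
  by rewrite (le_lt_trans (probability_le1 _ _))// ltry.
exists 1; split; rewrite ?num_real// => M M1 x _ /=.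
by rewrite (le_trans (f1 x))// ltW.
Qed.

Lemma integral_unif_angle (R : realType) (f : R -> R) :
  measurable_fun setT f -> (forall x, `|f x| <= 1) ->
  (\int[unif_angle R]_s (f s)%:E =
   ((2 * pi)^-1 * \int[@lebesgue_measure R]_(s in `[- pi, pi]) f s)%:E)%E.
Proof.
move=> mf f1.
have mEf : measurable_fun setT (EFin \o f) by exact/measurable_EFinP.
have intf : (@lebesgue_measure R).-integrable `[- pi, pi] (EFin \o f).
  apply: measurable_bounded_integrable => //.
  - by rewrite /= lebesgue_measure_itv/=; case: ifPn => // _; rewrite -EFinB ltry.
  - exact: measurable_funTS.
  - exists 1; split; rewrite ?num_real// => M M1 x _ /=.
    by rewrite (le_trans (f1 x))// ltW.
rewrite integralE !integral_uniform//;
  [|exact: measurable_funeneg|exact: measurable_funepos].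
rewrite -muleBr//; last exact: integrable_add_def.
rewrite -integralE EFinM /Rintegral fineK; last exact: integrable_fin_num.
by congr ((_)^-1%:E * _)%E; ring.
Qed.

(** * The limit variable and its characteristic function *)

Lemma J0E (R : realType) (x : R) :
  J0 x = Complex ((2 * pi)^-1 *
                    \int[@lebesgue_measure R]_(s in `[- pi, pi]) cos (x * sin s))
                 ((2 * pi)^-1 *
                    \int[@lebesgue_measure R]_(s in `[- pi, pi]) sin (x * sin s)).
Proof.
rewrite /J0 /cintegral /expi/=; set a := _^-1; set b := Rintegral _ _ _.
set c := Rintegral _ _ _.
by apply/eqP; rewrite eq_complex/=; apply/andP; split; apply/eqP; ring.
Qed.

Section limit_variable.
Context (R : realType).
Local Notation mR := (measurableTypeR R).
Context (g : R -> R) (mg : measurable_fun setT g).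

Definition limit_prob : probability (mR * mR)%type R :=
  (unif01 R \x unif_angle R)%E.

Lemma measurable_limit_variable :
  measurable_fun setT (fun z : mR * mR => g z.1 * sin z.2).
Proof.
apply: measurable_funM; first exact: measurableT_comp.
exact: (measurableT_comp (@measurable_sin R)).
Qed.

Definition limit_variable : {RV limit_prob >-> R} :=
  mfun_Sub (mem_set measurable_limit_variable).

(** Fubini with the angle integrated first leaves the integral of [kappa (g u)] over [u]. Cosine and
    sine as [psi] give the two parts of the characteristic function. *)
Lemma Rintegral_limit_variable (psi : R -> R) (t : R) (f : R -> R) (N : set R) :
  measurable_fun setT psi -> (forall x, `|psi x| <= 1) ->
  measurable N -> lebesgue_measure N = 0%E ->
  (forall x, `]0, 1[%classic x -> ~ N x -> g x = f x) ->
  \int[limit_prob]_z psi (t * limit_variable z) =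
  \int[@completed_lebesgue_measure R]_(u in `]0, 1[)
    ((2 * pi)^-1 *
      \int[@lebesgue_measure R]_(s in `[- pi, pi]) psi (t * f u * sin s)).
Proof.
move=> mpsi psi1 mN N0 gf; rewrite /Rintegral; congr fine.
pose kappa y := ((2 * pi)^-1 *
  \int[@lebesgue_measure R]_(s in `[- pi, pi]) psi (t * y * sin s))%:E.
pose F (z : mR * mR) := (psi (t * limit_variable z))%:E.
have mF : measurable_fun setT (fun z : mR * mR => psi (t * limit_variable z)).
  apply: measurableT_comp => //.
  by apply: measurable_funM => //; exact: measurable_limit_variable.
have iF : limit_prob.-integrable setT F by exact: bounded_integrable_prob.
have kappaE y : (\int[unif_angle R]_s (psi (t * y * sin s))%:E)%E = kappa y.
  rewrite integral_unif_angle//; apply: measurableT_comp => //.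
  by apply: measurable_funM => //; exact: measurable_sin.
have FE : fubini_F (unif_angle R) F = kappa \o g.
  apply/funext => u /=; rewrite -kappaE.
  by apply: eq_integral => s _; rewrite /F/= mulrA.
have mkg : measurable_fun setT (kappa \o g).
  by rewrite -FE; exact: measurable_fubini_F iF.
have := integral12_prod_meas1 iF; rewrite FE => <-.
rewrite (integral_unif01 mkg) -(completed_integralE (measurable_itv _) mkg).
have mD : (hlength R)^*%mu.-cara.-measurable (`]0, 1[%classic : set R).
  by apply: sub_completed; exact: measurable_itv.
have mkg' : measurable_fun
    (`]0, 1[%classic : set (caratheodory_type (hlength R)^*%mu)) (kappa \o g).
  move=> mD' B mB; apply: measurableI => //.
  by apply: sub_completed; rewrite -[X in measurable X]setTI; exact: mkg.
(* The passage from [g] to [f] takes place under the completed measure, whose completeness makes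
   [kappa \o f] measurable. *)
have aegf : ae_eq (@completed_lebesgue_measure R) `]0, 1[%classic
    (kappa \o g) (kappa \o f).
  exists N; split => //; first exact: sub_completed.
  move=> u /= /not_implyP[u01 kgf]; apply: contrapT => Nu.
  by apply: kgf; rewrite gf.
have mkf' :=
  ae_measurable_fun (@completed_lebesgue_measure_is_complete R) aegf mkg'.
exact: (@ae_eq_integral _ _ R (@completed_lebesgue_measure R) `]0, 1[%classic
  (kappa \o f) (kappa \o g) mD mkg' mkf' aegf).
Qed.

End limit_variable.

(** * Local integrability and the law of the given sequence *)

(** The compact intervals [K n] exhaust the open interval, and integrability on each includes
    measurability. *)
Lemma L1loc_measurable (R : realType) (f : R -> R) (q : R) :
  L1loc `]0, 1[ f ->
  (hlength R)^*%mu.-cara.-measurable (`]0, 1[ `&` [set x | f x < q]).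
Proof.
move=> hf.
pose K n : set R := `[n.+1%:R^-1, 1 - n.+1%:R^-1]%classic.
have KD n : K n `<=` `]0, 1[%classic.
  have n0 : 0 < n.+1%:R^-1 :> R by rewrite invr_gt0 ltr0n.
  move=> x; rewrite /K/= !in_itv/= => /andP[x0 x1].
  by rewrite (lt_le_trans n0 x0) (le_lt_trans x1)// ltrBlDr ltrDl.
have -> : `]0, 1[ `&` [set x | f x < q] =
    \bigcup_n (K n `&` (EFin \o f) @^-1` `]-oo, q%:E[).
  apply/seteqP; split => x; last first.
    by move=> [n _ [/KD Dx]]; rewrite /= in_itv/= lte_fin.
  rewrite /= in_itv/= => -[/andP[x0 x1] fxq].
  have [n nx] := ltr_add_invr x0.
  have [m mx] := ltr_add_invr x1.
  rewrite add0r in nx.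
  exists (maxn n m) => //; split; last by rewrite /= in_itv/= lte_fin.
  have nI : (maxn n m).+1%:R^-1 <= n.+1%:R^-1 :> R.
    by rewrite lef_pV2 ?posrE ?ltr0n// ler_nat ltnS leq_maxl.
  have mI : (maxn n m).+1%:R^-1 <= m.+1%:R^-1 :> R.
    by rewrite lef_pV2 ?posrE ?ltr0n// ler_nat ltnS leq_maxr.
  rewrite /K/= in_itv/= (le_trans nI (ltW nx))/= lerBrDr.
  by rewrite (le_trans _ (ltW mx))// lerD2l.
apply: bigcupT_measurable => n.
have mK : (hlength R)^*%mu.-cara.-measurable (K n).
  by apply: sub_completed; exact: measurable_itv.
have /measurable_int mf := hf (K n) (@segment_compact _ _ _) (@KD n).
by apply: (mf mK); exact: emeasurable_itv.
Qed.

Lemma ae_eq_probability d (T : measurableType d) (R : realType)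
    (P : probability T R) (A B : set T) :
  measurable A -> measurable B -> {ae P, forall w, A w <-> B w} -> P A = P B.
Proof.
move=> mA mB AB.
rewrite -(setIT A) -(setIT B) -!integral_indic//.
apply: ae_eq_integral => //; [exact/measurable_EFinP/measurable_indic..|].
apply: filterS AB => w AB _; congr (_%:E); rewrite !indicE; congr (_%:R).
by congr nat_of_bool; apply/idP/idP => /set_mem/AB/mem_set.
Qed.

Lemma distribution_uniform01_ae d (T : measurableType d) (R : realType)
    (P : probability T R) (U X : {RV P >-> R}) (h : R -> R) (A : set R) :
  uniform01 U -> measurable_fun setT h -> {ae P, forall w, X w = h (U w)} ->
  measurable A -> distribution P X A = unif01 R [set u | A (h u)].
Proof.
move=> hU mh Xh mA.
have mhA : measurable [set u | A (h u)].
  by rewrite -[X in measurable X]setTI; exact: mh.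
rewrite -[RHS](hU _ mhA); rewrite /distribution /pushforward.
apply: ae_eq_probability.
- exact: measurable_funPTI.
- exact: measurable_funPTI.
- by apply: filterS Xh => w; rewrite /preimage/= => ->.
Qed.

Lemma uniform01_ae d (T : measurableType d) (R : realType)
    (P : probability T R) (U : {RV P >-> R}) (N : set R) :
  uniform01 U -> measurable N -> lebesgue_measure N = 0%E ->
  {ae P, forall w, `]0, 1[%classic (U w) /\ ~ N (U w)}.
Proof.
move=> hU mN N0; pose M := N `|` ~` `]0, 1[%classic.
have mD : measurable (`]0, 1[%classic : set R) by exact: measurable_itv.
have mM : measurable M by apply: measurableU => //; exact: measurableC.
exists (U @^-1` M); split.
- exact: measurable_funPTI.
- rewrite -[LHS]/(distribution P U M) hU// uniform_prob01E//.
  apply/eqP; rewrite -measure_le0.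
  (* Within [[0, 1]], the set [M] contains only points of [N] and the two endpoints. *)
  pose E : set R := [set 0] `|` [set 1].
  have -> : (0 = lebesgue_measure (N `|` E))%E.
    rewrite measureU0//; first exact: measurableU.
    by rewrite measureU0//; exact: lebesgue_measure_set1.
  apply: le_measure; rewrite ?inE//; [exact: measurableI| |].
    by apply: measurableU => //; exact: measurableU.
  move=> x [[Nx|/= x01]]; first by left.
  rewrite /= in_itv/= => /andP[x0 x1]; right; apply: contrapT => xE.
  apply: x01; rewrite in_itv/= !lt_neqAle x0 x1 !andbT; apply/andP.
  by split; apply/eqP => xx; apply: xE; [left|right].
- move=> w /= /not_andP[Uw|/contrapT Uw]; [by right|by left].
Qed.

(* [f] is a total function of which only the values on ]0, 1[ matter, and it is
   only Lebesgue measurable, so that f(U) sin(nU) is a random variable up to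
   almost sure equality: [V n] is any representative of it. *)
Theorem theorem2p2 (R : realType) (d : measure_display) (T : measurableType d)
    (P : probability T R) (U : {RV P >-> R}) (hU : uniform01 U)
    (f : R -> R) (hf : L1loc `]0, 1[ f)
    (V : nat -> {RV P >-> R})
    (hV : forall n : nat,
      {ae P, forall w : T, V n w = f (U w) * sin (n%:R * U w)}) :
  exists (d' : measure_display) (T' : measurableType d')
         (P' : probability T' R) (Vlim : {RV P' >-> R}),
    cvg_in_law V Vlim /\
    forall t : R,
      charfun Vlim t =
      cintegral (@completed_lebesgue_measure R) `]0, 1[
        (fun u : R => J0 (t * f u)).
Proof.
have mD : measurable (`]0, 1[%classic : set R) by exact: measurable_itv.
have [g [N [mg mN N0 gf]]] :=
  borel_representative mD (fun q => L1loc_measurable q hf).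
exists _, _, (limit_prob R), (limit_variable mg); split; last first.
  move=> t; rewrite /charfun /cintegral; congr Complex.
    rewrite (Rintegral_limit_variable mg t (@measurable_cos R) _ mN N0 gf).
      by apply: eq_Rintegral => u _; rewrite J0E.
    by move=> x; rewrite ler_norml cos_geN1 cos_le1.
  rewrite (Rintegral_limit_variable mg t (@measurable_sin R) _ mN N0 gf).
    by apply: eq_Rintegral => u _; rewrite J0E.
  by move=> x; rewrite ler_norml sin_geN1 sin_le1.
apply: cvg_in_law_thickening => e eta e0 eta0.
have := sin_oscillation_le mg e0 eta0; apply: filterS => n H A B mA mB AB.
have mh : measurable_fun setT (fun u : R => g u * sin (n%:R * u)).
  apply: measurable_funM => //.
  by apply: (measurableT_comp (@measurable_sin R)); exact: measurable_funM.
rewrite (distribution_uniform01_ae hU mh _ mA); first exact: H.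
(* Almost surely [U] lies in the open interval and off [N], where [g] equals [f]. *)
apply: filterS2 (hV n) (uniform01_ae hU mN N0) => w -> [Uw NUw].
by rewrite gf.
Qed.
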